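(* Let $(x(t),\lambda(t))$, $t\ge t_0$, be a (global) trajectory of the dynamical system $$\begin{cases}\ddot{x}(t)+\dfrac{\alpha}{t}\dot{x}(t)+\nabla f(x(t))+A^\top\bigl(\lambda(t)+\theta t\dot{\lambda}(t)\bigr)+\beta A^\top(Ax(t)-b)=0,\\ \ddot{\lambda}(t)+\dfrac{\alpha}{t}\dot{\lambda}(t)-\bigl(A(x(t)+\theta t\dot{x}(t))-b\bigr)=0,\end{cases}$$ where $\alpha>3$, $\theta\in\left(\frac{1}{\alpha-1},\frac12\right)$ and $\beta\ge 0$. Let $x^*\in\mathcal{S}$. Then, as $t\to+\infty$: (i) $\|(\dot x(t),\dot\lambda(t))\|=o\left(\frac1t\right)$; (ii) $|f(x(t))-f(x^* )|=o\left(\frac1{t^2}\right)$ and $\|Ax(t)-b\|=o\left(\frac1{t^2}\right)$.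
   Context: Standing setting: $f:\mathbb{R}^n\to\mathbb{R}$ is convex and continuously differentiable ($\nabla f$ is not assumed Lipschitz), $A\in\mathbb{R}^{m\times n}$, $b\in\mathbb{R}^m$, $t_0>0$. The set of primal optimal solutions $\mathcal{S}=\operatorname{argmin}\{f(x): Ax=b\}$ is assumed nonempty; $f(x^* )$ is the optimal value, the same for every $x^*\in\mathcal{S}$. A trajectory is a global (twice differentiable) solution $(x,\lambda):[t_0,+\infty)\to\mathbb{R}^n\times\mathbb{R}^m$ of the system; existence of a global solution is assumed. *)

(* Defs.v *)
From HB Require Import structures.
From mathcomp Require Import all_boot all_order all_algebra.
From mathcomp Require Import all_classical all_reals all_analysis.

Set Implicit Arguments.
Unset Strict Implicit.
Unset Printing Implicit Defensive.

Import Order.TTheory GRing.Theory Num.Theory.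
Import numFieldNormedType.Exports.

Local Open Scope classical_set_scope.
Local Open Scope ring_scope.

(* Needed by the notation f =o_ +oo g. *)
Canonical pinfty_nbhs_filter_on (R : numFieldType) : filter_on R :=
  FilterType (pinfty_nbhs R) _.

(* The library norm `|v| on matrices is the sup norm. *)
Definition enorm (R : realType) (k : nat) (v : 'cV[R]_k) : R :=
  Num.sqrt (\sum_(i < k) v i ord0 ^+ 2).

Definition gradient (R : realType) (n : nat) (f : 'cV[R]_n -> R)
    (x : 'cV[R]_n) : 'cV[R]_n :=
  \col_(i < n) 'D_(delta_mx i ord0) f x.

Definition continuously_differentiable (R : realType) (n : nat)
    (f : 'cV[R]_n -> R) : Prop :=
  (forall x, differentiable f x) /\ continuous (gradient f).

(* Difference quotients are restricted to D, so that the derivative on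
   [t0, +oo[ is one-sided at t0 and two-sided elsewhere; values of the curve
   outside D are irrelevant. *)
Section derivative_within.
Context (R : realType) (V : normedModType R).
Implicit Types (D : set R) (u : R -> V).

Definition derivable_within D u : Prop :=
  forall t, D t -> cvg ((s - t)^-1 *: (u s - u t) @[s --> within D t^']).

Definition derive_within D u (t : R) : V :=
  lim ((s - t)^-1 *: (u s - u t) @[s --> within D t^']).

Definition twice_derivable_within D u : Prop :=
  derivable_within D u /\ derivable_within D (derive_within D u).

End derivative_within.

Definition primal_solutions (R : realType) (n m : nat) (f : 'cV[R]_n -> R)
    (A : 'M[R]_(m, n)) (b : 'cV[R]_m) : set 'cV[R]_n :=
  [set x | A *m x = b /\ forall y, A *m y = b -> f x <= f y].

Definition trajectory (R : realType) (n m : nat) (f : 'cV[R]_n -> R)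
    (A : 'M[R]_(m, n)) (b : 'cV[R]_m) (alpha theta beta t0 : R)
    (x : R -> 'cV[R]_n) (lambda : R -> 'cV[R]_m) : Prop :=
  let D : set R := [set t | t0 <= t] in
  let dx := derive_within D x in
  let ddx := derive_within D dx in
  let dlambda := derive_within D lambda in
  let ddlambda := derive_within D dlambda in
  [/\ twice_derivable_within D x,
      twice_derivable_within D lambda &
      forall t, t0 <= t ->
        ddx t + (alpha / t) *: dx t + gradient f (x t)
          + A^T *m (lambda t + (theta * t) *: dlambda t)
          + beta *: (A^T *m (A *m x t - b)) = 0
        /\
        ddlambda t + (alpha / t) *: dlambda t
          - (A *m (x t + (theta * t) *: dx t) - b) = 0].

(* Main.v *)
Require Import Defs.
From HB Require Import structures.
From mathcomp Require Import all_boot all_order all_algebra.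
From mathcomp Require Import all_classical all_reals all_analysis.
From mathcomp Require Import ring lra.

Import Order.TTheory GRing.Theory Num.Theory.
Import numFieldNormedType.Exports.

Local Open Scope classical_set_scope.
Local Open Scope ring_scope.

(** Fix a Lagrange multiplier ls at the solution xs, and shift the trajectory to
    u = x - xs, v = lambda - ls.  The multiplier term and the augmentation are
    absorbed into one convex function,
      F z = f z - f xs + <ls, A z - b> + (beta / 2) |A z - b|^2,
    which is nonnegative and whose gradient is zero wherever F is zero.  The
    system becomes
      u'' + (alpha / t) u' + grad F (x) + A^T (v + theta t v') = 0,
      v'' + (alpha / t) v' = A (u + theta t u').

    Dissipation.  Let xi = theta (alpha - 1) - 1 > 0.  In the derivative of
      E = (theta t)^2 F(x) + (|u + theta t u'|^2 + |v + theta t v'|^2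
          + xi |u|^2 + xi |v|^2) / 2
    the terms that couple u and v through A cancel, and convexity gives
    E' <= - c w / t with c > 0 and w = t^2 (F(x) + (|u'|^2 + |v'|^2) / 2)
    (is_derive_energy, denergy_le).  Hence u, v, t u', t v' and t^2 F(x) are
    bounded, and w is integrable in the logarithmic time ln t.  The claim about
    F and the velocities is that w tends to 0, so short spikes of w have to be
    excluded.

    No spikes.  The quantity w may vary quickly, because its derivative contains
    the coupling t^2 (<A u, v'> - <A u', v>).  Put h = t^2 A u.  The corrected
    quantity W = w + <h, v> is Lipschitz in ln t as soon as h is bounded
    (is_derive_W), and a dissipated quantity that is asymptotic to a Lipschitz
    one vanishes (dissipated_vanishes).  It remains to see that h is bounded and
    that <h, v> tends to 0.  If B is a generalised inverse of A, that is
    A B A = A, then <h, v> = <B h, A^T v>, so A^T v -> 0 is enough.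

    Euler equations.  The solutions k of t k' = r - c k with c > 0 are bounded
    when r is, and vanish when r does (euler_bounded, euler_vanishes).  The
    second equation of the system says that k = h - t v' / theta is such a
    solution with r a multiple of t v'; the first one says the same of
    k = u' / (theta t) + A^T v, with r made of grad F (x) and of terms in 1 / t^2.
    Here grad F (x) -> 0 by compactness: x stays in a compact set where F can be
    small only near its zeros, at which the continuous map grad F is zero
    (gradient_vanishes_at_minima).  So h is bounded, A^T v -> 0, and w -> 0.  In
    particular t v' -> 0, and the equation for h - t v' / theta now gives h -> 0.
    These limits are the rates of the velocities and of |A x - b|; the rate of f
    follows from f - f xs = F - <ls, A x - b> - (beta / 2) |A x - b|^2. *)

Set Implicit Arguments.
Unset Strict Implicit.
Unset Printing Implicit Defensive.

(** * The Euclidean inner product *)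

Section dot.
Context {R : realType}.

Definition dot {k : nat} (u v : 'cV[R]_k) : R :=
  \sum_(i < k) u i ord0 * v i ord0.

Lemma dotC k (u v : 'cV[R]_k) : dot u v = dot v u.
Proof. by apply: eq_bigr => i _; rewrite mulrC. Qed.

Lemma dotDl k (u v w : 'cV[R]_k) : dot (u + v) w = dot u w + dot v w.
Proof. by rewrite -big_split; apply: eq_bigr => i _; rewrite mxE mulrDl. Qed.

Lemma dotZl k (a : R) (u v : 'cV[R]_k) : dot (a *: u) v = a * dot u v.
Proof. by rewrite mulr_sumr; apply: eq_bigr => i _; rewrite mxE mulrA. Qed.

Lemma dotNl k (u v : 'cV[R]_k) : dot (- u) v = - dot u v.
Proof. by rewrite -scaleN1r dotZl mulN1r. Qed.

Lemma dotBl k (u v w : 'cV[R]_k) : dot (u - v) w = dot u w - dot v w.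
Proof. by rewrite dotDl dotNl. Qed.

Lemma dotDr k (u v w : 'cV[R]_k) : dot u (v + w) = dot u v + dot u w.
Proof. by rewrite dotC dotDl !(dotC _ u). Qed.

Lemma dotZr k (a : R) (u v : 'cV[R]_k) : dot u (a *: v) = a * dot u v.
Proof. by rewrite dotC dotZl dotC. Qed.

Lemma dotNr k (u v : 'cV[R]_k) : dot u (- v) = - dot u v.
Proof. by rewrite dotC dotNl dotC. Qed.

Lemma dotBr k (u v w : 'cV[R]_k) : dot u (v - w) = dot u v - dot u w.
Proof. by rewrite dotDr dotNr. Qed.

Lemma dot_polar k (u v : 'cV[R]_k) : dot u v + dot v u = 2 * dot u v.
Proof. by rewrite (dotC v) mulr2n mulrDl mul1r. Qed.

Lemma dot0l k (u : 'cV[R]_k) : dot 0 u = 0.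
Proof. by rewrite -(scale0r 0) dotZl mul0r. Qed.

Definition dotE := (dotDl, dotDr, dotBl, dotBr, dotNl, dotNr, dotZl, dotZr).

Lemma mulmx_dot k (u v : 'cV[R]_k) : (u^T *m v) ord0 ord0 = dot u v.
Proof. by rewrite mxE; apply: eq_bigr => i _; rewrite mxE. Qed.

Lemma dot_mulmx k l (A : 'M[R]_(k, l)) (u : 'cV[R]_l) (v : 'cV[R]_k) :
  dot (A *m u) v = dot u (A^T *m v).
Proof. by rewrite -!mulmx_dot trmx_mul mulmxA. Qed.

Lemma dot_ge0 k (u : 'cV[R]_k) : 0 <= dot u u.
Proof. by apply: sumr_ge0 => i _; rewrite -expr2 sqr_ge0. Qed.

Lemma dot_delta k (i : 'I_k) (v : 'cV[R]_k) : dot (delta_mx i ord0) v = v i ord0.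
Proof.
rewrite /dot (bigD1 i)//= big1 => [|j ji]; first by rewrite mxE !eqxx mul1r addr0.
by rewrite mxE (negPf ji) mul0r.
Qed.

Lemma sqr_coord_le k (u : 'cV[R]_k) i : u i ord0 ^+ 2 <= dot u u.
Proof.
rewrite /dot (bigD1 i)//= -expr2 lerDl.
by apply: sumr_ge0 => j _; rewrite -expr2 sqr_ge0.
Qed.

Lemma coord_le_dot k (u : 'cV[R]_k) i C : dot u u <= C -> `|u i ord0| <= C + 1.
Proof.
move=> /(le_trans (sqr_coord_le u i)); move: (u i ord0) => x xC.
by rewrite ler_norml; apply/andP; split; nra.
Qed.

Lemma dot_eq0 k (u : 'cV[R]_k) : dot u u = 0 -> u = 0.
Proof.
move=> u0; apply/matrixP => i j; rewrite (ord1 j) mxE; apply/eqP.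
by rewrite -sqrf_eq0 eq_le sqr_ge0 andbT -u0 sqr_coord_le.
Qed.

Lemma enormE k (u : 'cV[R]_k) : enorm u = Num.sqrt (dot u u).
Proof. by congr Num.sqrt; apply: eq_bigr => i _; rewrite expr2. Qed.

End dot.

(** * Derivatives of curves *)

Section deriv.
Context {R : realType}.
Implicit Types (t : R).

(** This rule and the next ones restate the library rules on explicit lambda
    terms, so that the derivative of a composite expression can be assembled as
    a proof term. *)
Lemma is_deriveD1 {V : normedModType R} (f g : R -> V) t df dg :
  is_derive t 1 f df -> is_derive t 1 g dg ->
  is_derive t 1 (fun s => f s + g s) (df + dg).
Proof. exact: is_deriveD. Qed.

Lemma is_deriveM1 (f g : R -> R) t df dg :
  is_derive t 1 f df -> is_derive t 1 g dg ->
  is_derive t 1 (fun s => f s * g s) (df * g t + f t * dg).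
Proof.
move=> hf hg; have fg := is_deriveM hf hg.
suff <- : f t *: dg + g t *: df = df * g t + f t * dg by exact: fg.
by rewrite addrC [g t *: df]mulrC.
Qed.

Lemma is_deriveZ1 (a : R) (f : R -> R) (t df : R) :
  is_derive t 1 f df -> is_derive t 1 (fun s => a * f s) (a * df).
Proof. exact: is_deriveZ. Qed.

Lemma is_derive_linear (a t : R) : is_derive t 1 (fun s => a * s) a.
Proof.
by apply: (is_derive_eq (is_deriveZ1 a (is_derive_id t 1))); rewrite mulr1.
Qed.

Lemma is_derive_mx k l (M : R -> 'M[R]_(k, l)) t (dM : 'M[R]_(k, l)) :
  is_derive t 1 M dM <-> forall i j, is_derive t 1 (fun s => M s i j) (dM i j).
Proof.
split=> [dMt i j|dMt].
  have dr : derivable M t 1 by [].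
  apply: DeriveDef; first exact: (iffLR (derivable_mxP M t 1)).
  by rewrite -(@derive_val _ _ _ _ _ _ _ dMt) derive_mx// mxE.
have dr : derivable M t 1.
  by apply/derivable_mxP => i j; exact: (@ex_derive _ _ _ _ _ _ _ (dMt i j)).
apply: DeriveDef => //; rewrite derive_mx//; apply/matrixP => i j.
by rewrite mxE (@derive_val _ _ _ _ _ _ _ (dMt i j)).
Qed.

Lemma is_derive_sum1 k (h : 'I_k -> R -> R) t (dh : 'I_k -> R) :
  (forall i, is_derive t 1 (h i) (dh i)) ->
  is_derive t 1 (fun s => \sum_(i < k) h i s) (\sum_(i < k) dh i).
Proof.
move=> hd; have := @is_derive_sum _ _ _ _ h t 1 dh hd.
by rewrite fct_sumE.
Qed.

Lemma is_derive_dot k (u v : R -> 'cV[R]_k) t du dv :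
  is_derive t 1 u du -> is_derive t 1 v dv ->
  is_derive t 1 (fun s => dot (u s) (v s)) (dot du (v t) + dot (u t) dv).
Proof.
move=> /is_derive_mx hu /is_derive_mx hv.
rewrite /dot -big_split/=; apply: is_derive_sum1 => i.
exact: is_deriveM1.
Qed.

Lemma is_derive_scale k l (c : R -> R) (u : R -> 'M[R]_(k, l)) t dc du :
  is_derive t 1 c dc -> is_derive t 1 u du ->
  is_derive t 1 (fun s => c s *: u s) (dc *: u t + c t *: du).
Proof.
move=> hc /is_derive_mx hu; apply/is_derive_mx => i j.
rewrite !mxE; under eq_fun do rewrite mxE.
exact: is_deriveM1.
Qed.

Lemma is_derive_mulmx k l (A : 'M[R]_(k, l)) (u : R -> 'cV[R]_l) t du :
  is_derive t 1 u du -> is_derive t 1 (fun s => A *m u s) (A *m du).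
Proof.
move=> /is_derive_mx hu; apply/is_derive_mx => i j.
rewrite !mxE; under eq_fun do rewrite mxE.
exact: is_derive_sum1.
Qed.

Lemma mvt (f df : R -> R) (a b : R) : a < b ->
  (forall x, a <= x <= b -> is_derive x 1 f (df x)) ->
  exists2 c, a < c < b & f b - f a = df c * (b - a).
Proof.
move=> ab fdf.
have [c] : exists2 c, c \in `]a, b[ & f b - f a = df c * (b - a).
  apply: MVT => // [x|].
    by rewrite in_itv/= => /andP[ax xb]; apply: fdf; rewrite !ltW.
  apply: continuous_in_subspaceT => x; rewrite inE/= in_itv/= => xab.
  apply/differentiable_continuous/derivable1_diffP.
  exact: (@ex_derive _ _ _ _ _ _ _ (fdf x xab)).
by rewrite in_itv/=; exists c.
Qed.

Lemma nonincr_of_deriv (f df : R -> R) (a b : R) : a <= b ->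
  (forall x, a <= x <= b -> is_derive x 1 f (df x)) ->
  (forall x, a <= x <= b -> df x <= 0) -> f b <= f a.
Proof.
rewrite le_eqVlt => /predU1P[->//|ab] fdf dle.
have [c /andP[ac cb]] := mvt ab fdf.
have : df c <= 0 by apply: dle; rewrite !ltW.
by move=> dc fE; rewrite -subr_le0 fE mulr_le0_ge0// subr_ge0 ltW.
Qed.

End deriv.

(** * Boundedness and limits at infinity; Euler equations *)

Section asymptotics.
Context {R : realType}.
Implicit Types F G k r : R -> R.

Definition bounded_at_oo F := exists C : R, \forall t \near +oo, `|F t| <= C.

Definition vanishes_at_oo F := F t @[t --> +oo] --> (0 : R).

Lemma vanishesP F : vanishes_at_oo F <->
  forall e : R, 0 < e -> \forall t \near +oo, `|F t| <= e.
Proof. exact: cvgr0Pnorm_le. Qed.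

Lemma near_oo_gt (T : R) : \forall t \near +oo, T < t.
Proof. by apply: nbhs_pinfty_gt; exact: num_real. Qed.

Lemma near_ooP (P : set R) :
  (\forall t \near +oo, P t) -> exists T, forall t, T < t -> P t.
Proof. by move=> [T [_ PT]]; exists T. Qed.

Lemma bounded_le F G :
  (\forall t \near +oo, `|F t| <= `|G t|) -> bounded_at_oo G -> bounded_at_oo F.
Proof.
move=> FG [C GC]; exists C; apply: filterS2 FG GC => t; exact: le_trans.
Qed.

Lemma boundedD F G :
  bounded_at_oo F -> bounded_at_oo G -> bounded_at_oo (fun t => F t + G t).
Proof.
move=> [C FC] [D GD]; exists (C + D); apply: filterS2 FC GD => t FC GD.
by rewrite (le_trans (ler_normD _ _))// lerD.
Qed.

Lemma boundedM F G :
  bounded_at_oo F -> bounded_at_oo G -> bounded_at_oo (fun t => F t * G t).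
Proof.
move=> [C FC] [D GD]; exists (C * D); apply: filterS2 FC GD => t FC GD.
by rewrite normrM ler_pM.
Qed.

Lemma bounded_at_oo_cst a : bounded_at_oo (fun=> a).
Proof. by exists `|a|; apply: nearW. Qed.

Lemma bounded_sum (k : nat) (F : 'I_k -> R -> R) :
  (forall i, bounded_at_oo (F i)) -> bounded_at_oo (fun t => \sum_i F i t).
Proof.
move=> FC; elim: k F FC => [|k ih] F FC.
  by under eq_fun do rewrite big_ord0; exact: bounded_at_oo_cst.
under eq_fun do rewrite big_ord_recl.
by apply: boundedD => //; apply: ih => i.
Qed.

Lemma vanishes_bounded F : vanishes_at_oo F -> bounded_at_oo F.
Proof. by move=> /vanishesP F0; exists 1; exact: F0. Qed.

Lemma vanishesD F G :
  vanishes_at_oo F -> vanishes_at_oo G -> vanishes_at_oo (fun t => F t + G t).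
Proof. by move=> F0 G0; rewrite /vanishes_at_oo -[0]addr0; exact: cvgD. Qed.

Lemma vanishes_le F G :
  (\forall t \near +oo, `|F t| <= `|G t|) -> vanishes_at_oo G -> vanishes_at_oo F.
Proof.
move=> FG /vanishesP G0; apply/vanishesP => e /G0.
by apply: filterS2 FG => t; exact: le_trans.
Qed.

Lemma vanishesM F G :
  bounded_at_oo F -> vanishes_at_oo G -> vanishes_at_oo (fun t => F t * G t).
Proof.
move=> [C FC] /vanishesP G0; apply/vanishesP => e e0.
have C0 : 0 < `|C| + 1 by rewrite ltr_wpDl.
have := G0 (e / (`|C| + 1)) (divr_gt0 e0 C0).
apply: filterS2 FC => t FC GC; rewrite normrM.
rewrite -(divfK (lt0r_neq0 C0) e) mulrC ler_pM//.
by rewrite (le_trans FC)// (le_trans (ler_norm _))// lerDl.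
Qed.

Lemma vanishesZ a F : vanishes_at_oo F -> vanishes_at_oo (fun t => a * F t).
Proof. exact: (vanishesM (bounded_at_oo_cst a)). Qed.

Lemma vanishes_sum (k : nat) (F : 'I_k -> R -> R) :
  (forall i, vanishes_at_oo (F i)) -> vanishes_at_oo (fun t => \sum_i F i t).
Proof.
move=> F0; elim: k F F0 => [|k ih] F F0.
  by under eq_fun do rewrite big_ord0; exact: cvg_cst.
under eq_fun do rewrite big_ord_recl.
by apply: vanishesD => //; apply: ih => i.
Qed.

Lemma vanishesV : vanishes_at_oo (fun t => t^-1).
Proof.
by apply/(@gtr0_cvgV0 _ _ _ _ id); [exact: near_oo_gt|exact: cvg_id].
Qed.

Lemma vanishes_powRV (c : R) : 0 < c -> vanishes_at_oo (fun t => (t `^ c)^-1).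
Proof.
move=> c0; apply/vanishesP => e e0; near=> t.
have t0 : 0 < t by near: t; exact: near_oo_gt.
have et : e^-1 `^ c^-1 <= t by apply: ltW; near: t; exact: near_oo_gt.
rewrite ger0_norm ?invr_ge0 ?powR_ge0// -[leRHS]invrK.
rewrite lef_pV2 ?posrE ?invr_gt0 ?powR_gt0//.
have -> : e^-1 = (e^-1 `^ c^-1) `^ c.
  by rewrite -powRrM mulVf ?lt0r_neq0// powRr1// invr_ge0 ltW.
by apply: ge0_ler_powR => //; rewrite ?nnegrE ?powR_ge0 ?ltW.
Unshelve. all: by end_near. Qed.

(** With integrating factor t^c, the function t^c (k - e) has derivative
    t^(c - 1) (r - c e) <= 0. *)
Lemma euler_upper k r (c e T : R) : 0 < T -> 0 < c ->
  (forall t, T <= t -> is_derive t 1 k ((r t - c * k t) / t)) ->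
  (forall t, T <= t -> r t <= c * e) ->
  forall t, T <= t -> k t <= e + T `^ c * `|k T - e| * (t `^ c)^-1.
Proof.
move=> T0 c0 dk re t Tt.
have t0 : 0 < t by exact: lt_le_trans Tt.
have : t `^ c * (k t - e) <= T `^ c * (k T - e).
  apply: (@nonincr_of_deriv _ (fun s => s `^ c * (k s - e))
    (fun s => s `^ (c - 1) * (r s - c * e))) => // s /andP[Ts _].
    have s0 : 0 < s by exact: lt_le_trans Ts.
    apply: (is_derive_eq (is_deriveM1 (is_derive1_powR c s0)
      (is_deriveD1 (dk _ Ts) (is_derive_cst (- e) s 1)))).
    have -> : s `^ c = s * s `^ (c - 1) by rewrite mulr_powRB1// ltW.
    by rewrite /cst; field; rewrite lt0r_neq0.
  by rewrite mulr_ge0_le0 ?powR_ge0// subr_le0 re.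
have tc : 0 < t `^ c by rewrite powR_gt0.
rewrite -lerBlDl ler_pdivlMr// mulrC => /le_trans; apply.
by rewrite ler_wpM2l ?powR_ge0// ler_norm.
Qed.

Lemma euler_eventually k r (c e : R) : 0 < c -> 0 < e ->
  (\forall t \near +oo, is_derive (t : R) 1 k ((r t - c * k t) / t)) ->
  (\forall t \near +oo, `|r t| <= c * e) ->
  \forall t \near +oo, `|k t| <= 2 * e.
Proof.
move=> c0 e0 dk re.
have upper h s : (\forall t \near +oo, is_derive (t : R) 1 h ((s t - c * h t) / t)) ->
    (\forall t \near +oo, s t <= c * e) -> \forall t \near +oo, h t <= 2 * e.
  move=> [T1 [_ dh]] [T2 [_ se]].
  pose T := Num.max 1 (Num.max (T1 + 1) (T2 + 1)).
  have T1T : T1 < T by rewrite !lt_max ltrDl ltr01 orbT.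
  have T2T : T2 < T by rewrite !lt_max ltrDl ltr01 !orbT.
  have T0 : 0 < T by rewrite lt_max ltr01.
  have /vanishesP/(_ e e0) := (vanishesZ (T `^ c * `|h T - e|) (vanishes_powRV c0)).
  apply: filterS2 (near_oo_gt T) => t Tt small.
  have := @euler_upper h s c e T T0 c0.
  move=> /(_ (fun t Tt => dh t (lt_le_trans T1T Tt))).
  move=> /(_ (fun t Tt => se t (lt_le_trans T2T Tt)) t (ltW Tt)).
  move=> /le_trans; apply; rewrite mulr2n mulrDl mul1r lerD2l.
  by rewrite (le_trans (ler_norm _)).
have up : \forall t \near +oo, k t <= 2 * e.
  apply: upper dk _; apply: filterS re => t; exact: le_trans (ler_norm _).
have lo : \forall t \near +oo, - k t <= 2 * e.
  apply: (upper (fun t => - k t) (fun t => - r t)).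
    apply: filterS dk => t dk; apply: (is_derive_eq (is_deriveN dk)).
    by rewrite mulrN -opprD mulNr.
  by apply: filterS re => t; apply: le_trans; rewrite -normrN ler_norm.
apply: filterS2 up lo => t up lo.
by rewrite ler_norml up andbT lerNl.
Qed.

Lemma euler_bounded k r (c : R) : 0 < c ->
  (\forall t \near +oo, is_derive (t : R) 1 k ((r t - c * k t) / t)) ->
  bounded_at_oo r -> bounded_at_oo k.
Proof.
move=> c0 dk [C rC]; exists (2 * ((`|C| + 1) / c)).
apply: euler_eventually dk _ => //; first by rewrite divr_gt0// ltr_wpDl.
apply: filterS rC => t /le_trans; apply.
by rewrite mulrC divfK ?lt0r_neq0// (le_trans (ler_norm _))// lerDl.
Qed.

Lemma euler_vanishes k r (c : R) : 0 < c ->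
  (\forall t \near +oo, is_derive (t : R) 1 k ((r t - c * k t) / t)) ->
  vanishes_at_oo r -> vanishes_at_oo k.
Proof.
move=> c0 dk /vanishesP r0; apply/vanishesP => e e0.
have -> : e = 2 * (e / 2) by field.
by apply: euler_eventually dk _; rewrite ?divr_gt0//; apply: r0; rewrite mulr_gt0 ?divr_gt0.
Qed.

End asymptotics.

(** * Vanishing of a dissipated quantity *)

(** Suppose that w > e at some late time t.  The function W, and therefore w up to
    a small error, needs a time interval of length proportional to t to decrease,
    since t W' is bounded.  Over such an interval E drops by a fixed amount.  This
    is impossible at late times, because E is nonincreasing and bounded below. *)
Lemma dissipated_vanishes (R : realType) (E dE w W dW : R -> R) (c : R) :
  0 < c ->
  (\forall t \near +oo, [/\ is_derive (t : R) 1 E (dE t),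
     dE t <= - (c * (w t / t)), 0 <= E t & 0 <= w t]) ->
  (\forall t \near +oo, is_derive (t : R) 1 W (dW t)) ->
  bounded_at_oo (fun t => t * dW t) ->
  vanishes_at_oo (fun t => W t - w t) ->
  vanishes_at_oo w.
Proof.
move=> c0 nE nW [C0 nC] /vanishesP nWw; apply/vanishesP => e e0.
pose C := `|C0| + 1.
have C_gt0 : 0 < C by rewrite ltr_wpDl.
pose d := e / (4 * C).
have d0 : 0 < d by rewrite divr_gt0// mulr_gt0.
have e40 : 0 < e / 4 by rewrite divr_gt0.
(* The drop of [E] over [[t, (1 + d) t]] when [w >= e / 4] there. *)
pose h := c * (e / 4) * d / (1 + d).
have h0 : 0 < h.
  by rewrite /h divr_gt0 ?(mulr_gt0 _ d0) ?(mulr_gt0 c0 e40) ?addr_gt0.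
have [T1 nT1] := near_ooP (filterI nE (filterI nW (filterI nC (nWw _ e40)))).
pose T := Num.max 0 T1.
have {}nT t : T < t -> [/\ 0 < t, [/\ is_derive (t : R) 1 E (dE t),
     dE t <= - (c * (w t / t)), 0 <= E t & 0 <= w t],
     is_derive (t : R) 1 W (dW t), `|t * dW t| <= C & `|W t - w t| <= e / 4].
  rewrite gt_max => /andP[t0 /nT1[? [? [tC ?]]]]; split => //.
  by rewrite (le_trans tC)// (le_trans (ler_norm _))// lerDl.
pose S := [set E t | t in [set t | T < t]].
have Sinf : has_inf S.
  split; first by exists (E (T + 1)), (T + 1) => //=; rewrite ltrDl.
  by exists 0 => _ [t /= /nT[_ [_ _ ? _] _ _ _] <-].
(* From [t1] on, the energy stays within [h] of its infimum. *)
have [_ [t1 /= Tt1 <-] Et1] := inf_adherent h0 Sinf.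
apply: filterS (near_oo_gt t1) => t t1t.
have Tt := lt_trans Tt1 t1t.
have [t0 [_ _ _ wt0] _ _ Wwt] := nT _ Tt.
rewrite ger0_norm// leNgt; apply/negP => wt.
have EtE : E t <= E t1.
  apply: (@nonincr_of_deriv _ E dE); first exact: ltW.
    by move=> x /andP[t1x _]; have [] := nT _ (lt_le_trans Tt1 t1x) => _ [].
  move=> x /andP[t1x _].
  have [x0 [_ dEx _ wx] _ _ _] := nT _ (lt_le_trans Tt1 t1x).
  by apply: le_trans dEx _; rewrite oppr_le0 mulr_ge0 ?divr_ge0 ?(ltW c0) ?(ltW x0).
pose s := (1 + d) * t.
have stE : s - t = d * t by rewrite /s; ring.
have ts : t < s by rewrite -subr_gt0 stE mulr_gt0.
(* [w] stays above [e / 4] on [[t, s]]: [W] loses at most [C * d = e / 4] there,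
   and passing between [w] and [W] costs [e / 4] at each end. *)
have wx x : t <= x <= s -> e / 4 <= w x.
  move=> /andP[tx xs].
  have [x0 _ _ _ Wwx] := nT _ (lt_le_trans Tt tx).
  have : W t - W x <= C * d.
    have [->|tnx] := eqVneq t x; first by rewrite subrr mulr_ge0 ?ltW.
    have ltx : t < x by rewrite lt_neqAle tnx.
    have [y /andP[ty yx] WE] : exists2 y, t < y < x & W x - W t = dW y * (x - t).
      apply: mvt => // z /andP[tz _].
      by have [] := nT _ (lt_le_trans Tt tz).
    have [y0 _ _ dWy _] := nT _ (lt_trans Tt ty).
    rewrite -opprB WE -mulNr.
    have dWy' : - dW y <= C / t.
      rewrite ler_pdivlMr//; apply: le_trans dWy; rewrite normrM (gtr0_norm y0).
      rewrite mulrC (@le_trans _ _ (t * `|dW y|))//.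
        by rewrite ler_pM2l// -normrN ler_norm.
      by rewrite ler_wpM2r// ltW.
    apply: (@le_trans _ _ (C / t * (x - t))).
      by rewrite ler_wpM2r// subr_ge0.
    rewrite -mulrA ler_pM2l// mulrC ler_pdivrMr//; lra.
  have -> : C * d = e / 4 by rewrite /d; field; rewrite lt0r_neq0.
  move: Wwt Wwx; rewrite !ler_norml => /andP[? ?] /andP[? ?].
  lra.
have [y /andP[ty ys] EE] : exists2 y, t < y < s & E s - E t = dE y * (s - t).
  apply: mvt => // z /andP[tz _].
  by have [] := nT _ (lt_le_trans Tt tz) => _ [].
have [y0 [_ dEy _ _] _ _ _] := nT _ (lt_trans Tt ty).
have wy : e / 4 <= w y by apply: wx; rewrite !ltW.
have Es : inf S <= E s.
  apply: ge_inf; first by case: Sinf.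
  by exists s => //=; exact: lt_trans ts.
have : h <= E t - E s.
  rewrite -opprB EE stE -mulNr.
  apply: (@le_trans _ _ (c * (e / 4 / s) * (d * t))).
    rewrite /h /s le_eqVlt; apply/orP; left; apply/eqP.
    by field; rewrite !lt0r_neq0// addr_gt0.
  apply: ler_wpM2r; first by rewrite mulr_ge0 ?ltW.
  rewrite lerNr (le_trans dEy)// lerN2.
  have s0 : 0 < s by apply: lt_trans ts.
  rewrite ler_pM2l// ler_pM ?invr_ge0 ?(ltW e40) ?(ltW s0)//.
  by rewrite lef_pV2 ?posrE// ltW.
lra.
Qed.

(** * Bounded and vanishing curves *)

Section vector_asymptotics.
Context {R : realType}.

Definition bounded_curve k (z : R -> 'cV[R]_k) :=
  forall i, bounded_at_oo (fun t => z t i ord0).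

Definition vanishing_curve k (z : R -> 'cV[R]_k) :=
  forall i, vanishes_at_oo (fun t => z t i ord0).

Lemma bounded_curve_of_dot k (z : R -> 'cV[R]_k) :
  bounded_at_oo (fun t => dot (z t) (z t)) -> bounded_curve z.
Proof.
move=> [C zC] i; exists (C + 1); apply: filterS zC => t.
by rewrite ger0_norm ?dot_ge0//; exact: coord_le_dot.
Qed.

Lemma bounded_dot k (y z : R -> 'cV[R]_k) : bounded_curve y -> bounded_curve z ->
  bounded_at_oo (fun t => dot (y t) (z t)).
Proof. by move=> hy hz; apply: bounded_sum => i; exact: boundedM. Qed.

Lemma vanishes_dot k (y z : R -> 'cV[R]_k) :
  bounded_curve y -> vanishing_curve z -> vanishes_at_oo (fun t => dot (y t) (z t)).
Proof. by move=> hy hz; apply: vanishes_sum => i; exact: vanishesM. Qed.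

Lemma bounded_curveD k (y z : R -> 'cV[R]_k) : bounded_curve y ->
  bounded_curve z -> bounded_curve (fun t => y t + z t).
Proof.
by move=> hy hz i; under eq_fun do rewrite mxE; exact: boundedD.
Qed.

Lemma bounded_curveZ k a (z : R -> 'cV[R]_k) : bounded_at_oo a ->
  bounded_curve z -> bounded_curve (fun t => a t *: z t).
Proof.
by move=> ha hz i; under eq_fun do rewrite mxE; exact: boundedM.
Qed.

Lemma bounded_curve_mulmx k l (A : 'M[R]_(k, l)) (z : R -> 'cV[R]_l) :
  bounded_curve z -> bounded_curve (fun t => A *m z t).
Proof.
move=> hz i; under eq_fun do rewrite mxE.
by apply: bounded_sum => j; exact: (boundedM (bounded_at_oo_cst _) (hz j)).
Qed.

Lemma vanishing_curveD k (y z : R -> 'cV[R]_k) : vanishing_curve y ->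
  vanishing_curve z -> vanishing_curve (fun t => y t + z t).
Proof.
by move=> hy hz i; under eq_fun do rewrite mxE; exact: vanishesD.
Qed.

Lemma vanishing_curveZl k (a : R -> R) (z : R -> 'cV[R]_k) : bounded_at_oo a ->
  vanishing_curve z -> vanishing_curve (fun t => a t *: z t).
Proof.
by move=> ha hz i; under eq_fun do rewrite mxE; exact: vanishesM.
Qed.

Lemma vanishing_curve_of_dot k (z : R -> 'cV[R]_k) :
  vanishes_at_oo (fun t => dot (z t) (z t)) -> vanishing_curve z.
Proof.
move=> /vanishesP z0 i; apply/vanishesP => e e0.
apply: filterS (z0 (e ^+ 2) (exprn_gt0 2 e0)) => t.
rewrite ger0_norm ?dot_ge0// => ze.
rewrite -(@ler_pXn2r _ 2) ?nnegrE ?(ltW e0)// real_normK ?num_real//.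
exact: le_trans (sqr_coord_le _ _) ze.
Qed.

Lemma vanishing_bounded_curve k (z : R -> 'cV[R]_k) :
  vanishing_curve z -> bounded_curve z.
Proof. by move=> hz i; exact: vanishes_bounded. Qed.

End vector_asymptotics.

(** * Rates for the shifted primal-dual system *)

Section primal_dual_curves.
(* [phi] and [gam] stand for a convex function and its gradient along the primal
   curve; [u] and [v] are measured from a saddle point. *)
Context {R : realType} (n m : nat) (A : 'M[R]_(m, n)) (alpha theta t0 : R).
Context (u du ddu : R -> 'cV[R]_n) (v dv ddv : R -> 'cV[R]_m).
Context (phi : R -> R) (gam : R -> 'cV[R]_n).
Hypotheses (t0_gt0 : 0 < t0) (theta_gt0 : 0 < theta) (theta_lt : theta < 1 / 2)
  (xi_gt0 : 0 < theta * (alpha - 1) - 1).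
Hypothesis uD : forall t : R, t0 < t -> is_derive t 1 u (du t).
Hypothesis duD : forall t : R, t0 < t -> is_derive t 1 du (ddu t).
Hypothesis vD : forall t : R, t0 < t -> is_derive t 1 v (dv t).
Hypothesis dvD : forall t : R, t0 < t -> is_derive t 1 dv (ddv t).
Hypothesis phiD : forall t : R, t0 < t -> is_derive t 1 phi (dot (gam t) (du t)).
Hypothesis phi_ge0 : forall t, t0 < t -> 0 <= phi t.
Hypothesis phi_le : forall t, t0 < t -> phi t <= dot (gam t) (u t).
Hypothesis dduE : forall t, t0 < t ->
  ddu t = - (alpha / t) *: du t - gam t - A^T *m (v t + (theta * t) *: dv t).
Hypothesis ddvE : forall t, t0 < t ->
  ddv t = - (alpha / t) *: dv t + A *m (u t + (theta * t) *: du t).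
Hypothesis gam_vanishes :
  bounded_curve u -> vanishes_at_oo phi -> vanishing_curve gam.

Let gt0 t : t0 < t -> 0 < t. Proof. exact: lt_trans. Qed.
Let neq0 t : t0 < t -> t != 0. Proof. by move/gt0/lt0r_neq0. Qed.

Let p t := u t + (theta * t) *: du t.
Let q t := v t + (theta * t) *: dv t.
Let xi := theta * (alpha - 1) - 1.

Definition energy t :=
  theta * t * (theta * t) * phi t
  + 2^-1 * (dot (p t) (p t) + dot (q t) (q t) + xi * (dot (u t) (u t) + dot (v t) (v t))).

Definition denergy t :=
  2 * theta ^+ 2 * t * phi t - theta * t * dot (gam t) (u t)
  - xi * theta * t * (dot (du t) (du t) + dot (dv t) (dv t)).

(** Both shifted points have simple derivatives, because theta t absorbs the
    damping: p' = - xi u' - theta t (gam + A^T q) and q' = - xi v' + theta t A p.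
    In <p, p'> + <q, q'> the terms <p, A^T q> cancel, in <p, u'> and <q, v'> the
    terms <u, u'> and <v, v'> cancel against the xi part of the energy, and
    <u', gam> cancels against the derivative of phi. *)
Lemma is_derive_energy t : t0 < t -> is_derive t 1 energy (denergy t).
Proof.
move=> t0t; have tn0 := neq0 t0t.
have lin := is_derive_linear theta t.
have pD := is_deriveD1 (uD t0t) (is_derive_scale lin (duD t0t)).
have qD := is_deriveD1 (vD t0t) (is_derive_scale lin (dvD t0t)).
have eD := is_deriveD1 (is_deriveM1 (is_deriveM1 lin lin) (phiD t0t))
  (is_deriveZ1 2^-1 (is_deriveD1 (is_deriveD1 (is_derive_dot pD pD) (is_derive_dot qD qD))
  (is_deriveZ1 xi (is_deriveD1 (is_derive_dot (uD t0t) (uD t0t)) (is_derive_dot (vD t0t) (vD t0t)))))).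
apply: (is_derive_eq eD).
have -> : du t + (theta *: du t + (theta * t) *: ddu t) =
    - xi *: du t - (theta * t) *: (gam t + A^T *m q t).
  rewrite dduE// -/(q t); move: (A^T *m q t) => a.
  by apply/matrixP => i j; rewrite !mxE /xi; field.
have -> : dv t + (theta *: dv t + (theta * t) *: ddv t) =
    - xi *: dv t + (theta * t) *: (A *m p t).
  rewrite ddvE// -/(p t); move: (A *m p t) => a.
  by apply/matrixP => i j; rewrite !mxE /xi; field.
rewrite -/(p t) -/(q t) /denergy.
have up : dot (du t) (p t) = dot (du t) (u t) + theta * t * dot (du t) (du t).
  by rewrite /p !dotE.
have gp : dot (gam t) (p t) = dot (gam t) (u t) + theta * t * dot (gam t) (du t).
  by rewrite /p !dotE.
have vq : dot (dv t) (q t) = dot (dv t) (v t) + theta * t * dot (dv t) (dv t).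
  by rewrite /q !dotE.
move: (p t) (q t) up gp vq => P Q up gp vq.
rewrite !dot_polar !(dotBl, dotDl, dotZl) (dot_mulmx A) [dot P (A^T *m Q)]dotC up gp vq.
by field.
Qed.

Let near_gt0 : \forall t \near +oo, t0 < t. Proof. exact: near_oo_gt. Qed.

Let y t := t *: du t.
Let eta t := t *: dv t.
Let h t := (t * t) *: (A *m u t).
Let w t := t * t * (phi t + 2^-1 * (dot (du t) (du t) + dot (dv t) (dv t))).

Let rate := Num.min (theta * (1 - 2 * theta)) (2 * xi * theta).

Let rate_gt0 : 0 < rate.
Proof.
have xi0 : 0 < xi := xi_gt0.
by rewrite lt_min !mulr_gt0// subr_gt0 -ltr_pdivlMl// mulrC.
Qed.

Lemma w_ge0 t : t0 < t -> 0 <= w t.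
Proof.
move=> t0t; have t_gt0 := ltW (gt0 t0t).
by rewrite /w mulr_ge0 ?mulr_ge0// addr_ge0 ?phi_ge0// mulr_ge0 ?addr_ge0 ?dot_ge0.
Qed.

(** By convexity phi <= <gam, u>, so the two terms in phi combine to at most
    - theta (1 - 2 theta) t phi, with 1 - 2 theta > 0. *)
Lemma denergy_le t : t0 < t -> denergy t <= - (rate * (w t / t)).
Proof.
move=> t0t; have t_gt0 := gt0 t0t; have phi0 := phi_ge0 t0t.
have := phi_le t0t; have := dot_ge0 (du t); have := dot_ge0 (dv t).
have -> : w t / t = t * (phi t + 2^-1 * (dot (du t) (du t) + dot (dv t) (dv t))).
  by rewrite /w; field; exact: neq0.
rewrite /denergy; move: (dot (du t) _) (dot (dv t) _) (dot (gam t) _) => a b c b0 a0 pc.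
have r1 : rate <= theta * (1 - 2 * theta) by rewrite ge_min lexx.
have r2 : rate <= 2 * xi * theta by rewrite ge_min lexx orbT.
have tc : theta * t * phi t <= theta * t * c by rewrite ler_pM2l// mulr_gt0.
have s1 : rate * (t * phi t) <= theta * (1 - 2 * theta) * (t * phi t).
  by rewrite ler_wpM2r// mulr_ge0// ltW.
have s2 : rate * (t * (a + b)) <= 2 * xi * theta * (t * (a + b)).
  by rewrite ler_wpM2r// mulr_ge0 ?addr_ge0// ltW.
move: s1 s2 tc; move: rate xi => r x; lra.
Qed.

Lemma denergy_le0 t : t0 < t -> denergy t <= 0.
Proof.
move=> t0t; apply: le_trans (denergy_le t0t) _.
by rewrite oppr_le0 mulr_ge0 ?divr_ge0 ?w_ge0 ?(ltW rate_gt0) ?(ltW (gt0 t0t)).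
Qed.

Lemma energy_terms_ge0 t : t0 < t ->
  [/\ 0 <= theta * t * (theta * t) * phi t, 0 <= dot (p t) (p t),
      0 <= dot (q t) (q t), 0 <= xi * dot (u t) (u t) & 0 <= xi * dot (v t) (v t)].
Proof.
move=> t0t; have phi0 := phi_ge0 t0t; have t_gt0 := ltW (gt0 t0t).
by have := ltW xi_gt0; split; rewrite ?mulr_ge0 ?dot_ge0// ltW.
Qed.

Lemma energy_bounded : exists C, \forall t \near +oo, energy t <= C.
Proof.
exists (energy (t0 + 1)); apply: filterS (near_oo_gt (t0 + 1)) => t tt.
have t0x x : t0 + 1 <= x -> t0 < x by apply: lt_le_trans; rewrite ltrDl.
apply: (@nonincr_of_deriv _ energy denergy); first exact: ltW.
  by move=> x /andP[/t0x + _]; exact: is_derive_energy.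
by move=> x /andP[/t0x + _]; exact: denergy_le0.
Qed.

Lemma energy_ge0 t : t0 < t -> 0 <= energy t.
Proof.
move=> /energy_terms_ge0[? ? ? ? ?]; rewrite /energy; lra.
Qed.

(** Each summand of the energy is nonnegative, hence bounded; the next lemmas read
    this off summand by summand. *)
Lemma bounded_of_energy (F : R -> R) (a : R) : 0 < a ->
  (forall t, t0 < t -> 0 <= F t /\ a * F t <= energy t) -> bounded_at_oo F.
Proof.
move=> a0 FE; have [C EC] := energy_bounded.
exists (a^-1 * C); apply: filterS2 near_gt0 EC => t /FE[F0 aF] EC.
by rewrite ger0_norm// ler_pdivlMl// (le_trans aF).
Qed.

Lemma u_bounded : bounded_curve u.
Proof.
apply/bounded_curve_of_dot/(@bounded_of_energy _ (2^-1 * xi)).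
  by rewrite mulr_gt0.
move=> t t0t; split; first exact: dot_ge0.
have [? ? ? ? ?] := energy_terms_ge0 t0t; rewrite /energy; lra.
Qed.

Lemma v_bounded : bounded_curve v.
Proof.
apply/bounded_curve_of_dot/(@bounded_of_energy _ (2^-1 * xi)).
  by rewrite mulr_gt0.
move=> t t0t; split; first exact: dot_ge0.
have [? ? ? ? ?] := energy_terms_ge0 t0t; rewrite /energy; lra.
Qed.

Lemma p_bounded : bounded_curve p.
Proof.
apply/bounded_curve_of_dot/(@bounded_of_energy _ 2^-1) => // t t0t.
split; first exact: dot_ge0.
have [? ? ? ? ?] := energy_terms_ge0 t0t; rewrite /energy; lra.
Qed.

Lemma q_bounded : bounded_curve q.
Proof.
apply/bounded_curve_of_dot/(@bounded_of_energy _ 2^-1) => // t t0t.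
split; first exact: dot_ge0.
have [? ? ? ? ?] := energy_terms_ge0 t0t; rewrite /energy; lra.
Qed.

Lemma scaled_velocity_bounded k (z dz : R -> 'cV[R]_k) :
  bounded_curve (fun t => z t + (theta * t) *: dz t) -> bounded_curve z ->
  bounded_curve (fun t => t *: dz t).
Proof.
move=> zdz zb.
have -> : (fun t => t *: dz t) =
    (fun t => theta^-1 *: ((z t + (theta * t) *: dz t) + -1 *: z t)).
  apply/funext => t; rewrite scaleN1r addrC addKr scalerA mulrA mulVf ?mul1r//.
  exact: lt0r_neq0.
apply: bounded_curveZ; first exact: bounded_at_oo_cst.
apply: bounded_curveD => //.
by apply: (bounded_curveZ (a := fun=> -1)) => //; exact: bounded_at_oo_cst.
Qed.

Lemma y_bounded : bounded_curve y.
Proof. exact: scaled_velocity_bounded p_bounded u_bounded. Qed.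

Lemma eta_bounded : bounded_curve eta.
Proof. exact: scaled_velocity_bounded q_bounded v_bounded. Qed.

Lemma phi_bounded : bounded_at_oo (fun t => t * t * phi t).
Proof.
apply: (@bounded_of_energy _ (theta * theta)); first by rewrite mulr_gt0.
move=> t t0t; have [? ? ? ? ?] := energy_terms_ge0 t0t.
have phi0 := phi_ge0 t0t; have t_gt0 := ltW (gt0 t0t).
split; first by rewrite !mulr_ge0.
rewrite /energy; lra.
Qed.

Lemma phi_vanishes : vanishes_at_oo phi.
Proof.
apply: (@vanishes_le _ _ (fun t => (t * t * phi t) * t^-1 * t^-1)).
  by apply: filterS near_gt0 => t /neq0 tn0; rewrite le_eqVlt; apply/orP; left;
    apply/eqP; congr `|_|; field.
apply: vanishesM; last exact: vanishesV.
by apply: vanishes_bounded; apply: vanishesM; [exact: phi_bounded|exact: vanishesV].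
Qed.

Lemma gam_to_0 : vanishing_curve gam.
Proof. exact: gam_vanishes u_bounded phi_vanishes. Qed.

(** By the dual equation, t^2 A u - t v' / theta relaxes to a multiple of t v':
    subtracting t v' / theta removes the uncontrolled term t^3 A u'. *)
Let rel_rate := (1 - 2 * theta) / theta.
Let rel_gain := (theta * (alpha - 1) - (1 - 2 * theta)) / theta ^+ 2.
Let rel t := h t - theta^-1 *: eta t.

Let rel_rate_gt0 : 0 < rel_rate.
Proof. by rewrite divr_gt0// subr_gt0 -ltr_pdivlMl// mulrC. Qed.

Lemma is_derive_rel t i : t0 < t ->
  is_derive t 1 (fun s => rel s i ord0)
    ((rel_gain * eta t i ord0 - rel_rate * rel t i ord0) / t).
Proof.
move=> t0t; have tn0 := neq0 t0t.
have tD := is_derive_id t (1 : R).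
have hD := is_derive_scale (is_deriveM1 tD tD) (is_derive_mulmx A (uD t0t)).
have eD := is_derive_scale tD (dvD t0t).
have relD := is_deriveD1 hD (is_derive_scale (is_derive_cst (- theta^-1) t 1) eD).
have -> : (fun s => rel s i ord0) = (fun s =>
    ((s * s) *: (A *m u s) + - theta^-1 *: (s *: dv s)) i ord0).
  by apply/funext => s; rewrite /rel scaleNr.
apply: (is_derive_eq (iffLR (is_derive_mx _ _ _) relD i ord0)).
rewrite ddvE// mulmxDr -scalemxAr /rel /h /eta.
move: (A *m u t) (A *m du t) => a b; rewrite !mxE /rel_rate /rel_gain /cst.
by field; rewrite tn0 lt0r_neq0.
Qed.

Lemma rel_bounded : bounded_curve rel.
Proof.
move=> i; apply: (euler_bounded rel_rate_gt0 (r := fun t => rel_gain * eta t i ord0)).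
  by apply: filterS near_gt0 => t; exact: is_derive_rel.
exact: (boundedM (bounded_at_oo_cst _) (eta_bounded i)).
Qed.

Let hE : h = (fun t => rel t + theta^-1 *: eta t).
Proof. by apply/funext => t; rewrite /rel subrK. Qed.

Lemma h_bounded : bounded_curve h.
Proof.
rewrite hE; apply: bounded_curveD; first exact: rel_bounded.
apply: (bounded_curveZ (a := fun=> theta^-1)); last exact: eta_bounded.
exact: bounded_at_oo_cst.
Qed.

(** By the primal equation, u' / (theta t) + A^T v relaxes to a vanishing quantity:
    adding u' / (theta t) removes the term t A^T v', and the added term is itself
    of order 1 / t^2. *)
Let zeta t := (theta * t)^-1 *: du t + A^T *m v t.
Let zeta_forcing t i := theta^-1 *
  ((theta^-1 - 1 - alpha) * (t^-1 * (t^-1 * y t i ord0)) - gam t i ord0).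

Lemma is_derive_zeta t i : t0 < t ->
  is_derive t 1 (fun s => zeta s i ord0)
    ((zeta_forcing t i - theta^-1 * zeta t i ord0) / t).
Proof.
move=> t0t; have tn0 := neq0 t0t.
have thn0 : theta * t != 0 by rewrite mulf_neq0// lt0r_neq0.
have iD := is_deriveV thn0 (is_derive_linear theta t).
have zD := is_deriveD1 (is_derive_scale iD (duD t0t)) (is_derive_mulmx A^T (vD t0t)).
apply: (is_derive_eq (iffLR (is_derive_mx _ _ _) zD i ord0)).
rewrite dduE// mulmxDr -scalemxAr /zeta_forcing /zeta /y.
move: (A^T *m v t) (A^T *m dv t) => a b; rewrite !mxE.
rewrite /GRing.scale/=.
by field; rewrite tn0 lt0r_neq0.
Qed.

Lemma zeta_vanishes : vanishing_curve zeta.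
Proof.
move=> i; apply: (euler_vanishes (r := fun t => zeta_forcing t i) (c := theta^-1)).
- by rewrite invr_gt0.
- by apply: filterS near_gt0 => t; exact: is_derive_zeta.
apply: vanishesZ; apply: vanishesD.
  apply: vanishesZ; under eq_fun do rewrite mulrC.
  apply: vanishesM (vanishesV (R := R)); under eq_fun do rewrite mulrC.
  apply: boundedM (y_bounded i) _; exact: vanishes_bounded (vanishesV (R := R)).
by under eq_fun do rewrite -mulN1r; exact: vanishesZ (gam_to_0 i).
Qed.

Lemma dual_residual_vanishes : vanishing_curve (fun t => A^T *m v t).
Proof.
have zE t : A^T *m v t = zeta t + (- (theta * t)^-1) *: du t.
  by rewrite /zeta scaleNr addrAC subrr add0r.
under eq_fun do rewrite zE.
apply: vanishing_curveD; first exact: zeta_vanishes.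
move=> i.
apply: (@vanishes_le _ _ (fun t => - theta^-1 * (y t i ord0 * t^-1 * t^-1))).
  apply: filterS near_gt0 => t /neq0 tn0; rewrite le_eqVlt; apply/orP; left.
  by apply/eqP; congr `|_|; rewrite /y !mxE; field; rewrite tn0 lt0r_neq0.
apply: vanishesZ; apply: vanishesM (vanishesV (R := R)).
apply: boundedM (y_bounded i) _; exact: vanishes_bounded (vanishesV (R := R)).
Qed.

(** The vector v need not vanish, only A^T v does; but h lies in the range of A,
    on which pairing with v can be expressed through A^T v by a generalised
    inverse of A. *)
Lemma coupling_vanishes : vanishes_at_oo (fun t => dot (h t) (v t)).
Proof.
have hvE t : dot (h t) (v t) = dot (pinvmx A *m h t) (A^T *m v t).
  rewrite -dot_mulmx mulmxA /h -!scalemxAr mulmxA mulmxKpV//.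
under eq_fun do rewrite hvE.
apply: vanishes_dot dual_residual_vanishes.
exact: bounded_curve_mulmx h_bounded.
Qed.

(** The term t^3 <A u', v> of t (t^2 <A u, v>)' cancels the same term of t w',
    so t W' is made of w and of the bounded curves y, eta, h and v only. *)
Let W t := w t + dot (h t) (v t).
Let dW t := t^-1 * (2 * w t - alpha * (dot (y t) (y t) + dot (eta t) (eta t))
  + 2 * dot (h t) (eta t) + 2 * dot (h t) (v t)).

Lemma is_derive_W t : t0 < t -> is_derive t 1 W (dW t).
Proof.
move=> t0t; have tn0 := neq0 t0t.
have tD := is_derive_id t (1 : R).
have hD := is_derive_scale (is_deriveM1 tD tD) (is_derive_mulmx A (uD t0t)).
have vvD := is_deriveD1 (is_derive_dot (duD t0t) (duD t0t)) (is_derive_dot (dvD t0t) (dvD t0t)).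
have wD := is_deriveM1 (is_deriveM1 tD tD) (is_deriveD1 (phiD t0t) (is_deriveZ1 2^-1 vvD)).
apply: (is_derive_eq (is_deriveD1 wD (is_derive_dot hD (vD t0t)))).
rewrite !dot_polar dduE// ddvE// /dW /w /y /eta /h.
rewrite !mulmxDr -!scalemxAr !dotE !(dot_mulmx A) ![dot (A^T *m _) _]dotC.
by field.
Qed.

Let wE t : w t = t * t * phi t + 2^-1 * (dot (y t) (y t) + dot (eta t) (eta t)).
Proof. by rewrite /w /y /eta !dotE; field. Qed.

Lemma w_vanishes : vanishes_at_oo w.
Proof.
apply: (dissipated_vanishes (E := energy) (dE := denergy) (W := W) (dW := dW)
  rate_gt0).
- apply: filterS near_gt0 => t t0t; split.
  + exact: is_derive_energy.
  + exact: denergy_le.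
  + exact: energy_ge0.
  + exact: w_ge0.
- by apply: filterS near_gt0 => t; exact: is_derive_W.
- apply: (@bounded_le _ _ (fun t => 2 * w t
      + (- alpha) * (dot (y t) (y t) + dot (eta t) (eta t))
      + 2 * dot (h t) (eta t) + 2 * dot (h t) (v t))).
    by apply: filterS near_gt0 => t /neq0 tn0; rewrite /dW mulrA divff// mul1r mulNr.
  have yeb : bounded_at_oo (fun t => dot (y t) (y t) + dot (eta t) (eta t)).
    by apply: boundedD; apply: bounded_dot; (exact: y_bounded || exact: eta_bounded).
  have cb a F : bounded_at_oo F -> bounded_at_oo (fun t => a * F t).
    exact: (boundedM (bounded_at_oo_cst a)).
  apply: boundedD; last by apply: cb; exact: bounded_dot h_bounded v_bounded.
  apply: boundedD; last by apply: cb; exact: bounded_dot h_bounded eta_bounded.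
  apply: boundedD; apply: (cb) => //.
  have -> : w = fun t => _ := funext wE.
  by apply: boundedD; [exact: phi_bounded|exact: cb].
under eq_fun do rewrite /W addrC addKr.
exact: coupling_vanishes.
Qed.

Lemma scaled_terms_le t : t0 < t ->
  [/\ `|t * t * phi t| <= `|w t|, `|dot (y t) (y t)| <= `|2 * w t|
    & `|dot (eta t) (eta t)| <= `|2 * w t| ].
Proof.
move=> t0t; have phi0 := phi_ge0 t0t; have t_gt0 := ltW (gt0 t0t).
have w0 := w_ge0 t0t.
have tp0 : 0 <= t * t * phi t by rewrite !mulr_ge0.
have := wE t; have := dot_ge0 (y t); have := dot_ge0 (eta t) => e0 y0 wtE.
move: (w t) w0 wtE => wt w0 wtE.
by rewrite !ger0_norm ?mulr_ge0//; split; lra.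
Qed.

Lemma scaled_phi_vanishes : vanishes_at_oo (fun t => t * t * phi t).
Proof.
apply: vanishes_le w_vanishes; apply: filterS near_gt0 => t.
by case/scaled_terms_le.
Qed.

Lemma dot_y_vanishes : vanishes_at_oo (fun t => dot (y t) (y t)).
Proof.
apply: vanishes_le (vanishesZ 2 w_vanishes); apply: filterS near_gt0 => t.
by case/scaled_terms_le.
Qed.

Lemma dot_eta_vanishes : vanishes_at_oo (fun t => dot (eta t) (eta t)).
Proof.
apply: vanishes_le (vanishesZ 2 w_vanishes); apply: filterS near_gt0 => t.
by case/scaled_terms_le.
Qed.

(** The Euler equation is used a second time, now with a vanishing forcing. *)
Lemma h_vanishes : vanishing_curve h.
Proof.
have etav := vanishing_curve_of_dot dot_eta_vanishes.
rewrite hE; apply: vanishing_curveD => [i|].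
  apply: (euler_vanishes rel_rate_gt0 (r := fun t => rel_gain * eta t i ord0)).
    by apply: filterS near_gt0 => t; exact: is_derive_rel.
  exact: vanishesZ (etav i).
apply: (vanishing_curveZl (a := fun=> theta^-1)) etav.
exact: bounded_at_oo_cst.
Qed.

Lemma primal_dual_rates :
  [/\ vanishes_at_oo (fun t => t * t * phi t),
      vanishing_curve (fun t => t *: du t),
      vanishing_curve (fun t => t *: dv t) &
      vanishing_curve (fun t => (t * t) *: (A *m u t))].
Proof.
split; [exact: scaled_phi_vanishes| | |exact: h_vanishes].
- exact: vanishing_curve_of_dot dot_y_vanishes.
- exact: vanishing_curve_of_dot dot_eta_vanishes.
Qed.

End primal_dual_curves.

(** * One-sided derivatives, gradients and multipliers *)

(** At an interior point of the half-line, the filter restricted to the half-line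
    contains a full punctured neighbourhood. *)
Lemma is_derive_of_within (R : realType) (V : normedModType R) (t0 t : R)
    (z : R -> V) :
  derivable_within [set s | t0 <= s] z -> t0 < t ->
  is_derive t 1 z (derive_within [set s | t0 <= s] z t).
Proof.
move=> zD t0t; have := zD t (ltW t0t).
rewrite /derive_within; set l := lim _ => zl.
have {}zl : h^-1 *: ((z \o shift t) (h *: 1) - z t) @[h --> 0^'] --> l.
  move=> P /zl[e /= e0 eP].
  have d0 : 0 < Num.min e (t - t0) by rewrite lt_min e0 subr_gt0.
  exists (Num.min e (t - t0)) => //= h.
  rewrite /= sub0r normrN lt_min => /andP[he ht] hn0.
  have := eP (h + t); rewrite /= addrK /GRing.scale/= mulr1; apply.
  - by rewrite opprD addrCA subrr addr0 normrN.
  - by rewrite -subr_eq0 addrK.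
  - by move: ht; rewrite ltr_norml => /andP[? _]; lra.
by apply: DeriveDef; [apply/cvg_ex; exists l|exact: cvg_lim].
Qed.

Section gradients.
Context {R : realType} (n : nat).
Implicit Types (f : 'cV[R]_n -> R) (x y : 'cV[R]_n) (z : R -> 'cV[R]_n).

Lemma diff_gradient f x y : differentiable f x ->
  'd f x y = dot (gradient f x) y.
Proof.
move=> fx; have -> : y = \sum_(i < n) y i ord0 *: delta_mx i ord0.
  by rewrite [LHS]matrix_sum_delta; apply: eq_bigr => i _; rewrite big_ord1.
rewrite linear_sum dotC /dot; apply: eq_bigr => i _.
rewrite linearZ mxE deriveE//; congr (_ *: _).
rewrite summxE (bigD1 i)//= big1 ?addr0 ?mxE ?eqxx ?mulr1// => j ji.
by rewrite !mxE eq_sym (negPf ji) mulr0.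
Qed.

Lemma is_derive_comp_gradient f z t dz : differentiable f (z t) ->
  is_derive t 1 z dz ->
  is_derive t 1 (fun s => f (z s)) (dot (gradient f (z t)) dz).
Proof.
move=> fz zD; have zdiff : differentiable z t by apply/derivable1_diffP.
apply: DeriveDef.
  by apply/derivable1_diffP; exact: differentiable_comp.
rewrite deriveE; last exact: differentiable_comp.
rewrite diff_comp//= diff_gradient// -deriveE//.
by rewrite (@derive_val _ _ _ _ _ _ _ zD).
Qed.

Lemma is_derive_segment x y (t : R) : is_derive t 1 (fun s => x + s *: y) y.
Proof.
have yD := is_derive_scale (is_derive_id t (1 : R)) (is_derive_cst y t 1).
apply: (is_derive_eq (is_deriveD1 (is_derive_cst x t 1) yD)).
by rewrite add0r scale1r scaler0 addr0.
Qed.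

Lemma is_derive_along f x y : differentiable f x ->
  is_derive (0 : R) 1 (fun s => f (x + s *: y)) (dot (gradient f x) y).
Proof.
move=> fx.
have := @is_derive_comp_gradient f (fun s => x + s *: y) 0 y.
by rewrite scale0r addr0; apply => //; exact: is_derive_segment.
Qed.

(** The difference quotients of f from x in the direction y - x are at most
    f y - f x by convexity; let the step tend to 0 from the right. *)
Lemma convex_gradient_le f x y : convex_function [set: 'cV[R]_n] f ->
  differentiable f x -> f x + dot (gradient f x) (y - x) <= f y.
Proof.
move=> fconv fx; rewrite addrC -lerBrDr.
have [/cvg_ex[l /= dl] <-] := is_derive_along (y - x) fx.
rewrite /derive (cvg_lim _ dl)//.
have {}dl := cvg_dnbhs_at_right dl.
rewrite -(cvg_lim _ dl)//; apply: limr_le; first by apply/cvg_ex; exists l.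
near=> s.
have s0 : 0 < s by near: s; exact: nbhs_right_gt.
have s1 : s <= 1 by near: s; exact: nbhs_right_le.
rewrite /= scale0r !addr0 /GRing.scale/= mulr1 ler_pdivrMl//.
have := fconv (Itv01 (ltW s0) s1) y x; rewrite !inE => /(_ Logic.I Logic.I).
rewrite convRE/=.
have -> : conv (Itv01 (ltW s0) s1) (y : convex_lmodType 'cV[R]_n) x = x + s *: (y - x).
  rewrite /conv/= /unstable.onem scalerBl scale1r scalerBr.
  by rewrite addrCA.
suff : f (x + s *: (y - x)) <= s * f y + unstable.onem s * f x ->
  f (x + s *: (y - x)) - f x <= s * (f y - f x) by [].
rewrite /unstable.onem; lra.
Unshelve. all: by end_near. Qed.

Lemma line_min_eq0 f (g : 'cV[R]_n -> 'cV[R]_n) x y :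
  (forall s : R,
    is_derive s 1 (fun r => f (x + r *: y)) (dot (g (x + s *: y)) y)) ->
  (forall s : R, f x <= f (x + s *: y)) -> dot (g x) y = 0.
Proof.
move=> fD fmin; have [_] := fD 0; rewrite scale0r addr0 => <-.
have fmin0 : is_derive (0 : R) 1 (fun r : R => f (x + r *: y)) 0.
  apply: (@derive1_at_min R _ (-1 : R) (1 : R)) => //.
  - by rewrite in_itv/= ltrN10 ltr01.
  - by move=> s _; rewrite scale0r addr0.
exact: derive_val.
Qed.

(** The solution minimises f along every line with direction in the kernel of A,
    so the gradient is orthogonal to this kernel, hence lies in the row space of A. *)
Lemma lagrange_multiplier m (A : 'M[R]_(m, n)) (b : 'cV[R]_m) f xstar :
  (forall x, differentiable f x) ->
  primal_solutions f A b xstar ->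
  exists lstar, gradient f xstar + A^T *m lstar = 0.
Proof.
move=> fd [Axb xmin].
have ker0 y : A *m y = 0 -> dot (gradient f xstar) y = 0.
  move=> Ay; apply: (@line_min_eq0 f (gradient f)).
    move=> s; apply: is_derive_comp_gradient => //; exact: is_derive_segment.
  by move=> s; apply: xmin; rewrite mulmxDr -scalemxAr Ay scaler0 addr0.
have : ((gradient f xstar)^T <= A)%MS.
  rewrite submxE; apply/eqP/matrixP => i j; rewrite mxE [RHS]mxE.
  have := ker0 (col j (cokermx A)); rewrite [X in A *m X]colE mulmxA mulmx_coker mul0mx.
  move=> /(_ erefl) gk; rewrite -[RHS]gk; apply: eq_bigr => l _.
  by rewrite (ord1 i) !mxE.
move=> /submxP[D gE]; exists (- D^T); rewrite mulmxN -trmx_mul -gE trmxK.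
by rewrite subrr.
Qed.

Lemma trmx_continuous k l : continuous (fun M : 'M[R]_(k, l) => M^T).
Proof.
move=> M P [Q MQ QP]; exists (fun i j => Q j i) => [i j|N NQ].
  by have := MQ j i; rewrite mxE.
by apply: QP => i j; rewrite mxE; exact: NQ.
Qed.

(** Let K be the compact set of points of a large cube where the i-th entry of g
    is at least e in absolute value.  On K the function f is positive, hence
    bounded below by a positive constant, whereas f tends to 0 along the curve. *)
Lemma gradient_vanishes_at_minima f (g : 'cV[R]_n -> 'cV[R]_n) z :
  continuous f -> (forall i, continuous (fun x => g x i ord0)) ->
  (forall x, 0 <= f x) -> (forall x, f x = 0 -> g x = 0) ->
  bounded_curve z -> vanishes_at_oo (fun t => f (z t)) ->
  vanishing_curve (fun t => g (z t)).
Proof.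
move=> fc gc f0 fg zb /vanishesP fz i; apply/vanishesP => e e0.
have [C zC] : exists C, \forall t \near +oo, forall j, `|z t j ord0| <= C.
  have [C dC] := bounded_dot zb zb; exists (C + 1); apply: filterS dC => t.
  by rewrite ger0_norm ?dot_ge0// => dC j; exact: coord_le_dot.
(* Compactness of cubes is stated on row vectors, hence the transpositions. *)
pose K := [set r : 'rV[R]_n | (forall j, `[- C, C]%classic (r ord0 j))] `&`
  [set r | e <= `|g r^T i ord0| ].
have Kc : compact K.
  apply: compact_closedI.
    by apply: (@rV_compact R n (fun=> `[- C, C]%classic)) => j; exact: segment_compact.
  apply: (@closed_comp _ _ (fun r : 'rV[R]_n => `|g r^T i ord0|) [set x | e <= x]).
    move=> r _; apply: continuous_comp; last exact: norm_continuous.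
    apply: (@continuous_comp _ _ _ (fun r : 'rV[R]_n => r^T) (fun x => g x i ord0)).
      exact: trmx_continuous.
    exact: gc.
  exact: closed_ge.
have [K0|Kn0] := pselect (K !=set0); last first.
  apply: filterS zC => t zC; rewrite leNgt; apply/negP => eg; apply: Kn0.
  exists (z t)^T; split => /=; last by rewrite trmxK ltW.
  by move=> j; rewrite mxE in_itv/= -ler_norml.
have fKc : {within K, continuous (fun r : 'rV[R]_n => f r^T)}.
  apply: continuous_subspaceT => r; apply: continuous_comp; last exact: fc.
  exact: trmx_continuous.
have [c] := EVT_min_rV K0 Kc fKc; rewrite inE => -[_ /= gc0] cmin.
have fc0 : 0 < f c^T.
  rewrite lt_def f0 andbT; apply/eqP => /fg gc1.
  by move: gc0; rewrite gc1 mxE normr0 leNgt e0.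
have fc2 : 0 < f c^T / 2 by rewrite divr_gt0.
apply: filterS2 zC (fz _ fc2) => t zC ft; rewrite leNgt; apply/negP => eg.
have := cmin (z t)^T; rewrite inE trmxK => /(_ _) H.
have : f c^T <= f (z t).
  apply: H; split => /=; last by rewrite trmxK ltW.
  by move=> j; rewrite mxE in_itv/= -ler_norml.
move: ft; rewrite ger0_norm//; lra.
Qed.

Lemma continuousD1 f h : continuous f -> continuous h ->
  continuous (fun x => f x + h x).
Proof. by move=> fc hc x; exact: (cvgD (fc x) (hc x)). Qed.

Lemma continuousZ1 f (a : R) : continuous f -> continuous (fun x => a * f x).
Proof. by move=> fc x; exact: (cvgM (cvg_cst a) (fc x)). Qed.

Lemma dot_continuous k (g h : 'cV[R]_n -> 'cV[R]_k) :
  (forall i, continuous (fun x => g x i ord0)) ->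
  (forall i, continuous (fun x => h x i ord0)) ->
  continuous (fun x => dot (g x) (h x)).
Proof.
move=> gc hc; apply: continuous_big => [|i _ x]; first exact: add_continuous.
exact: (cvgM (gc i x) (hc i x)).
Qed.

Lemma mulmx_continuous k (B : 'M[R]_(k, n)) i :
  continuous (fun x : 'cV[R]_n => (B *m x) i ord0).
Proof.
under eq_fun do rewrite mxE.
apply: continuous_big => [|j _ x]; first exact: add_continuous.
exact: (cvgM (cvg_cst (B i j)) (@coord_continuous _ _ _ j ord0 x)).
Qed.

End gradients.

(** * The augmented Lagrangian gap *)

Section augmented_lagrangian.
Context {R : realType} (n m : nat) (f : 'cV[R]_n -> R) (A : 'M[R]_(m, n))
  (b : 'cV[R]_m) (beta : R) (xstar : 'cV[R]_n) (lstar : 'cV[R]_m).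
Hypotheses (fconv : convex_function [set: 'cV[R]_n] f)
  (fC1 : continuously_differentiable f) (beta_ge0 : 0 <= beta)
  (Axstar : A *m xstar = b) (kkt : gradient f xstar + A^T *m lstar = 0).

Definition lagrangian_gap x := f x - f xstar + dot lstar (A *m x - b)
  + beta * (2^-1 * dot (A *m x - b) (A *m x - b)).

Definition lagrangian_gradient x :=
  gradient f x + A^T *m lstar + beta *: (A^T *m (A *m x - b)).

Let fdiff x : differentiable f x. Proof. exact: (fC1.1). Qed.

Let residualE x : A *m x - b = A *m (x - xstar).
Proof. by rewrite mulmxBr Axstar. Qed.

Lemma is_derive_gap (z : R -> 'cV[R]_n) (t : R) dz : is_derive t 1 z dz ->
  is_derive t 1 (fun s => lagrangian_gap (z s)) (dot (lagrangian_gradient (z t)) dz).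
Proof.
move=> zD; have fD := is_derive_comp_gradient (fdiff (z t)) zD.
have gD := is_deriveD1 (is_derive_mulmx A zD) (is_derive_cst (- b) t 1).
have lD := is_derive_dot (is_derive_cst lstar t 1) gD.
have qD := is_deriveZ1 beta (is_deriveZ1 2^-1 (is_derive_dot gD gD)).
have fD' := is_deriveD1 fD (is_derive_cst (- f xstar) t 1).
apply: (is_derive_eq (is_deriveD1 (is_deriveD1 fD' lD) qD)).
rewrite !addr0 dot_polar dot0l /lagrangian_gradient !dotDl dotZl.
by rewrite !(dot_mulmx A^T) trmxK /cst [dot (A *m dz) _]dotC; field.
Qed.

(** The gradient inequality at xstar, where the gradient of f is
    - A^T lstar. *)
Lemma gap_ge0 x : 0 <= lagrangian_gap x.
Proof.
have := convex_gradient_le x fconv (fdiff xstar).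
have -> : gradient f xstar = - (A^T *m lstar) by apply/eqP; rewrite -addr_eq0 kkt.
rewrite dotNl dot_mulmx trmxK -residualE /lagrangian_gap.
have : 0 <= beta * (2^-1 * dot (A *m x - b) (A *m x - b)).
  by rewrite !mulr_ge0 ?dot_ge0.
lra.
Qed.

Lemma gap_le x : lagrangian_gap x <= dot (lagrangian_gradient x) (x - xstar).
Proof.
have := convex_gradient_le xstar fconv (fdiff x).
rewrite -(opprB x xstar) dotNr /lagrangian_gradient !dotDl dotZl.
rewrite !(dot_mulmx A^T) trmxK -residualE /lagrangian_gap.
have : 0 <= beta * dot (A *m x - b) (A *m x - b) by rewrite mulr_ge0 ?dot_ge0.
lra.
Qed.

(** A zero of the nonnegative gap is a minimum; move along the gradient itself. *)
Lemma gap_eq0 x : lagrangian_gap x = 0 -> lagrangian_gradient x = 0.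
Proof.
move=> x0; apply: dot_eq0; apply: (line_min_eq0 (f := lagrangian_gap)).
  by move=> s; apply: is_derive_gap; exact: is_derive_segment.
by move=> s; rewrite x0 gap_ge0.
Qed.

Let residual_continuous i : continuous (fun x => (A *m x - b) i ord0).
Proof.
under eq_fun do rewrite mxE.
by move=> x; exact: (cvgD (@mulmx_continuous _ _ _ A i x) (cvg_cst _)).
Qed.

Lemma gap_continuous : continuous lagrangian_gap.
Proof.
have fc : continuous f by move=> y; exact/differentiable_continuous.
have lc := dot_continuous (fun i => @cst_continuous _ _ (lstar i ord0)) residual_continuous.
have rc := dot_continuous residual_continuous residual_continuous.
apply: continuousD1 (continuousZ1 (continuousZ1 rc)).
apply: continuousD1 lc.
exact: continuousD1 fc (@cst_continuous _ _ _).
Qed.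

Lemma lagrangian_gradient_continuous i :
  continuous (fun x => lagrangian_gradient x i ord0).
Proof.
have -> : (fun x => lagrangian_gradient x i ord0) = (fun x =>
    gradient f x i ord0 + (A^T *m lstar) i ord0
    + beta * dot (A *m x - b) (A *m delta_mx i ord0)).
  apply/funext => y; rewrite dotC dot_mulmx dot_delta /lagrangian_gradient.
  by move: (gradient f y) (A^T *m lstar) (A^T *m _) => p q r; rewrite !mxE.
have gc : continuous (fun x => gradient f x i ord0).
  move=> x; exact: (@continuous_comp _ _ _ (gradient f)
    (fun M : 'cV[R]_n => M i ord0) x (fC1.2 x) (@coord_continuous _ _ _ i ord0 _)).
have rc := dot_continuous residual_continuous
  (fun j => @cst_continuous _ _ ((A *m delta_mx i ord0) j ord0)).
apply: continuousD1 (continuousZ1 rc).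
exact: continuousD1 gc (@cst_continuous _ _ _).
Qed.

End augmented_lagrangian.

(** * From vanishing curves to little-o rates *)

Section littleo.
Context {R : realType}.

Lemma littleo_of_vanishes (F a : R -> R) :
  (\forall t \near +oo, 0 < a t) -> vanishes_at_oo (fun t => a t * F t) ->
  (F : R -> R^o) =o_ +oo ((fun t => 1 / a t) : R -> R^o).
Proof.
move=> a0 /vanishesP aF; apply/eqoP => e e0.
apply: filterS2 a0 (aF e e0) => t a0.
rewrite normrM gtr0_norm// mulrC -ler_pdivlMr// => aFe.
have aE : `|1 / a t| = (a t)^-1 by rewrite div1r gtr0_norm ?invr_gt0.
by rewrite -aE in aFe.
Qed.

Lemma enorm_vanishes k (z : R -> 'cV[R]_k) :
  vanishing_curve z -> vanishes_at_oo (fun t => enorm (z t)).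
Proof.
move=> zv; have /vanishesP zz := vanishes_dot (vanishing_bounded_curve zv) zv.
apply/vanishesP => e e0; apply: filterS (zz (e ^+ 2) (exprn_gt0 2 e0)) => t.
rewrite enormE !ger0_norm ?dot_ge0 ?sqrtr_ge0// => ze.
by rewrite -[e]gtr0_norm// -sqrtr_sqr ler_sqrt// sqr_ge0.
Qed.

Lemma enormZ k (a : R) (z : 'cV[R]_k) : 0 <= a -> enorm (a *: z) = a * enorm z.
Proof.
move=> a0; rewrite !enormE !dotE mulrA -expr2 sqrtrM ?sqr_ge0// sqrtr_sqr.
by rewrite ger0_norm.
Qed.

Lemma enorm_littleo k (z : R -> 'cV[R]_k) (a : R -> R) :
  (\forall t \near +oo, 0 < a t) -> vanishing_curve (fun t => a t *: z t) ->
  ((fun t => enorm (z t)) : R -> R^o) =o_ +oo ((fun t => 1 / a t) : R -> R^o).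
Proof.
move=> a0 /enorm_vanishes av; apply: littleo_of_vanishes => //.
apply: vanishes_le av; apply: filterS a0 => t a0.
by rewrite enormZ// ltW.
Qed.

Lemma vanishing_col_mx k l (y : R -> 'cV[R]_k) (z : R -> 'cV[R]_l) :
  vanishing_curve y -> vanishing_curve z ->
  vanishing_curve (fun t => col_mx (y t) (z t)).
Proof.
move=> yv zv i; case: (split_ordP i) => j ->.
  by under eq_fun do rewrite col_mxEu; exact: yv.
by under eq_fun do rewrite col_mxEd; exact: zv.
Qed.

End littleo.

Theorem theorem3p1 (R : realType) (n m : nat) (f : 'cV[R]_n -> R)
    (A : 'M[R]_(m, n)) (b : 'cV[R]_m) (alpha theta beta t0 : R)
    (x : R -> 'cV[R]_n) (lambda : R -> 'cV[R]_m) (xstar : 'cV[R]_n) :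
  convex_function [set: 'cV[R]_n] f ->
  continuously_differentiable f ->
  0 < t0 ->
  3 < alpha ->
  1 / (alpha - 1) < theta -> theta < 1 / 2 ->
  0 <= beta ->
  trajectory f A b alpha theta beta t0 x lambda ->
  primal_solutions f A b xstar ->
  let dx := derive_within [set t | t0 <= t] x in
  let dlambda := derive_within [set t | t0 <= t] lambda in
  ((fun t => enorm (col_mx (dx t) (dlambda t))) : R -> R^o)
    =o_ +oo ((fun t => 1 / t) : R -> R^o)
  /\
  (((fun t => `|f (x t) - f xstar|) : R -> R^o)
     =o_ +oo ((fun t => 1 / t ^+ 2) : R -> R^o)
   /\
   ((fun t => enorm (A *m x t - b)) : R -> R^o)
     =o_ +oo ((fun t => 1 / t ^+ 2) : R -> R^o)).
Proof.
move=> fconv fC1 t0_gt0 alpha3 theta_gt theta_lt beta_ge0.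
move=> [[xD dxD] [lD dlD] ode] xsol dx dl.
have [lstar kkt] := lagrange_multiplier fC1.1 xsol.
have [Axs _] := xsol.
have alpha1 : 0 < alpha - 1 by lra.
have theta_gt0 : 0 < theta by rewrite (lt_trans _ theta_gt)// divr_gt0.
have xi_gt0 : 0 < theta * (alpha - 1) - 1.
  by rewrite subr_gt0 -ltr_pdivrMr.
pose gap := lagrangian_gap f A b beta xstar lstar.
pose gam := lagrangian_gradient f A b beta lstar.
have shiftD k (z : R -> 'cV[R]_k) dz c (t : R) :
    is_derive t 1 z dz -> is_derive t 1 (fun s => z s - c) dz.
  move=> zD; apply: (is_derive_eq (is_deriveD1 zD (is_derive_cst (- c) t 1))).
  exact: addr0.
have xD' t : t0 < t -> is_derive t 1 x (dx t) by exact: is_derive_of_within.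
have lD' t : t0 < t -> is_derive t 1 lambda (dl t) by exact: is_derive_of_within.
have residualE t : A *m x t - b = A *m (x t - xstar) by rewrite mulmxBr Axs.
have primal_eq t : t0 < t -> derive_within [set t | t0 <= t] dx t =
    - (alpha / t) *: dx t - gam (x t)
    - A^T *m (lambda t - lstar + (theta * t) *: dl t).
  move=> /ltW/ode[+ _]; rewrite -/dx -/dl [lambda t - lstar + _]addrAC (mulmxBr A^T _ lstar) /gam /lagrangian_gradient.
  move: (A^T *m (_ + _)) (A^T *m lstar) (A^T *m (_ - _)) => P Q S e1.
  apply/matrixP => i j; have := congr1 (fun M : 'cV[R]_n => M i j) e1.
  by rewrite !mxE; lra.
have dual_eq t : t0 < t -> derive_within [set t | t0 <= t] dl t =
    - (alpha / t) *: dl t + A *m (x t - xstar + (theta * t) *: dx t).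
  move=> /ltW/ode[_]; rewrite -/dx -/dl [x t - xstar + _]addrAC (mulmxBr A _ xstar) Axs.
  move: (A *m (_ + _)) => P e2.
  apply/matrixP => i j; have := congr1 (fun M : 'cV[R]_m => M i j) e2.
  by rewrite !mxE; lra.
have gam0 : bounded_curve (fun t => x t - xstar) ->
    vanishes_at_oo (fun t => gap (x t)) -> vanishing_curve (fun t => gam (x t)).
  move=> ub gap0; apply: (gradient_vanishes_at_minima (f := gap)) gap0.
  - exact: gap_continuous.
  - exact: lagrangian_gradient_continuous.
  - by move=> y; exact: gap_ge0.
  - by move=> y; exact: gap_eq0.
  - move=> i; have -> : (fun t => x t i ord0) =
        (fun t => (x t - xstar) i ord0 + xstar i ord0).
      by apply/funext => t; rewrite !mxE subrK.
    exact: boundedD (ub i) (bounded_at_oo_cst _).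
have [phiv dxv dlv hv] := @primal_dual_rates R n m A alpha theta t0
  (fun t => x t - xstar) dx (derive_within [set t | t0 <= t] dx)
  (fun t => lambda t - lstar) dl (derive_within [set t | t0 <= t] dl)
  (fun t => gap (x t)) (fun t => gam (x t)) t0_gt0 theta_gt0 theta_lt xi_gt0
  (fun t tt => shiftD _ _ _ _ _ (xD' t tt))
  (fun t tt => is_derive_of_within dxD tt)
  (fun t tt => shiftD _ _ _ _ _ (lD' t tt))
  (fun t tt => is_derive_of_within dlD tt)
  (fun t tt => is_derive_gap A b beta xstar lstar fC1 (xD' t tt))
  (fun t _ => gap_ge0 fconv fC1 beta_ge0 Axs kkt (x t))
  (fun t _ => gap_le lstar fconv fC1 beta_ge0 Axs (x t)) primal_eq dual_eq gam0.
have near_pos : \forall t \near +oo, 0 < (t : R) by exact: near_oo_gt.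
have near_pos2 : \forall t \near +oo, 0 < (t : R) ^+ 2.
  by apply: filterS near_pos => t t_gt0; rewrite exprn_gt0.
split; last split.
- apply: (@enorm_littleo _ _ (fun t => col_mx (dx t) (dl t)) id) => //.
  under eq_fun do rewrite scale_col_mx.
  exact: vanishing_col_mx.
- apply: (@littleo_of_vanishes _ _ (fun t => t ^+ 2)) => //.
  (* [t ^+ 2 * (f (x t) - f xstar)], expressed through the gap and [h = t^2 A u];
     the quadratic term is [t^-2 * dot h h]. *)
  have rv : vanishes_at_oo (fun t => t * t * gap (x t)
      + - dot lstar ((t * t) *: (A *m (x t - xstar)))
      + - (beta * (2^-1 * (t^-1 * (t^-1 * dot ((t * t) *: (A *m (x t - xstar)))
          ((t * t) *: (A *m (x t - xstar)))))))).
    have hh := vanishes_dot (vanishing_bounded_curve hv) hv.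
    have vb := vanishes_bounded (vanishesV (R := R)).
    apply: vanishesD; first apply: vanishesD => //.
      under eq_fun do rewrite -dotNl.
      by apply: vanishes_dot hv => i; exact: bounded_at_oo_cst.
    under eq_fun do rewrite -mulN1r.
    do 3![apply: vanishesZ].
    exact: vanishesM vb (vanishesM vb hh).
  apply: vanishes_le rv; apply: filterS near_pos => t t_gt0.
  rewrite normrM normr_id -normrM le_eqVlt; apply/orP; left; apply/eqP.
  congr `|_|; rewrite /gap /lagrangian_gap residualE !dotE.
  by field; rewrite lt0r_neq0.
- apply: (@enorm_littleo _ _ (fun t => A *m x t - b) (fun t => t ^+ 2)) => //.
  by under eq_fun do rewrite residualE expr2.
Qed.
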